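(* Assume $q_i>0$ for all $i\in\mathbb{N}$ and $\mathbb{E} Z=\infty$. Then, with probability one, $L_n\to-\infty$ as $n\to\infty$.
   Context: Let $Z,W,(Z_n)_{n\ge1},(W_n)_{n\ge1}$ be independent, identically distributed random variables taking values in $\mathbb{N}=\{1,2,3,\dots\}$, and let $q_i=\mathbb{P}(Z=i)$. Define sets $T_n\subset\mathbb{Z}$ recursively by $T_n=\{n\}$ for $n\le 0$ and $T_n=\{n\}\cup T_{n-Z_n}\cup T_{n-W_n}$ for $n\ge1$. Let $\mathcal{L}_n=T_n\cap\{0,-1,-2,\dots\}$ and $L_n=\min\mathcal{L}_n$. *)

(* Defs.v *)
From HB Require Import structures.
From mathcomp Require Import all_boot all_order all_algebra.
From mathcomp Require Import all_classical all_reals all_analysis.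
Set Implicit Arguments. Unset Strict Implicit. Unset Printing Implicit Defensive.
Import Order.TTheory GRing.Theory Num.Theory.
Local Open Scope classical_set_scope.
Local Open Scope ring_scope.

(* Index set of the i.i.d. family: (n, false) stands for Z_n and (n, true)
   for W_n.  Index n = 0 gives the generic copies Z = Z_0 and W = W_0. *)
Definition idx := (nat * bool)%type.

Section Prob.
Context (d : measure_display) (T : measurableType d) (R : realType)
        (P : probability T R).

Definition nat_rvs (X : idx -> T -> nat) : Prop :=
  forall i k, measurable [set t | X i t = k].

(* Mutual independence: product rule over every finite subfamily of
   distinct indices and every choice of (arbitrary, since nat carries the
   discrete sigma-algebra) sets A_j. *)
Definition mutually_independent (X : idx -> T -> nat) : Prop :=
  forall (J : seq idx) (A : idx -> set nat), uniq J ->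
    P [set t | forall j, j \in J -> A j (X j t)] =
    (\prod_(j <- J) P [set t | A j (X j t)])%E.

Definition identically_distributed (X : idx -> T -> nat) : Prop :=
  forall i j (A : set nat), P [set t | A (X i t)] = P [set t | A (X j t)].
End Prob.

(* Membership in the random set T_n (given the realised sequences
   z n = Z_n, w n = W_n):  T_n = {n} for n <= 0,
   T_n = {n} ∪ T_{n - Z_n} ∪ T_{n - W_n} for n >= 1.  This is the inductive
   (least) solution of the recursion, which is well-founded since Z_n,W_n >= 1. *)
Inductive inT (z w : nat -> nat) : int -> int -> Prop :=
| inT_self n : inT z w n n
| inT_Z n m : 0 < n -> inT z w (n - (z `|n|%N)%:Z) m -> inT z w n m
| inT_W n m : 0 < n -> inT z w (n - (w `|n|%N)%:Z) m -> inT z w n m.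

Definition is_min_L (z w : nat -> nat) (n l : int) : Prop :=
  [/\ inT z w n l, l <= 0 &
      forall m, inT z w n m -> m <= 0 -> l <= m].

(* L_n = min cal L_n  (the minimum exists; xget picks it). *)
Definition Lmin (z w : nat -> nat) (n : int) : int :=
  xget 0 [set l | is_min_L z w n l].

(* Main.v *)
Require Import Defs.
From HB Require Import structures.
From mathcomp Require Import all_boot all_order all_algebra.
From mathcomp Require Import all_classical all_reals all_analysis.
From mathcomp Require Import measurable_realfun zify ring lra.
Import Order.TTheory GRing.Theory Num.Theory.
Import numFieldNormedType.Exports.
Local Open Scope classical_set_scope.
Local Open Scope ring_scope.

(* Fix [M] and call a site [n] high when [L_n > - M]; for [n >= 1] this holds
   iff both [n - Z_n] and [n - W_n] are high. Let [x_N] be the conditional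
   probability that one jump from [N + 1] lands on a high site, so that [N + 1]
   is high with conditional probability [x_N ^ 2]. Let [Phi_N] be the sum of
   [P(Z > N - n)] over the high sites [n <= N]. Then
   [Phi_(N+1) - Phi_N = 1_(N+1 high) - x_N] has conditional mean
   [- x_N (1 - x_N)], and [Phi] is nonnegative, so the expectations of
   [x_N (1 - x_N)] and of [(1_(N+1 high) - x_N) ^ 2] are summable. Hence almost
   surely [1_(N+1 high) - x_N] tends to 0. A high [N] forces [x_N >= P(Z = 1)],
   thus eventually a high site is followed by a high site. If all late sites
   were high then the sum of [x_N (1 - x_N)] would dominate a multiple of
   the sum of [P(Z > M + N)], which diverges since [Z] has infinite mean. So
   only finitely many sites are high. *)

(** * Existence of the minimum of the nonpositive part of [T_n] *)

(** Induction on an upper bound [N] of [n]: for [n >= 1] the smaller of the minima for the two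
    landing sites is the minimum for [n]. *)
Lemma is_min_L_exists (z w : nat -> nat) :
  (forall k, 0 < z k)%N -> (forall k, 0 < w k)%N ->
  forall n : int, exists l, is_min_L z w n l.
Proof.
move=> z0 w0.
have nonpos (n : int) : n <= 0 -> exists l, is_min_L z w n l.
  move=> n0; exists n; split=> // [|m nm _]; first exact: inT_self.
  by case: nm n0 => // {}n {}m npos; rewrite leNgt npos.
suff main N (n : int) : n <= N%:Z -> exists l, is_min_L z w n l.
  by move=> n; apply: (main `|n|%N); lia.
elim: N n => [|N IH] n nN; first exact: nonpos.
have [n0|npos] := lerP n 0; first exact: nonpos.
have zn := z0 `|n|%N; have wn := w0 `|n|%N.
have [|l1 [T1 l10 min1]] := IH (n - (z `|n|%N)%:Z); first by lia.
have [|l2 [T2 l20 min2]] := IH (n - (w `|n|%N)%:Z); first by lia.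
have split_T m : inT z w n m -> m <= 0 ->
    inT z w (n - (z `|n|%N)%:Z) m \/ inT z w (n - (w `|n|%N)%:Z) m.
  by move=> nm; case: nm npos => [k k0|k m' _ ? _|k m' _ ? _]; [lia|left|right].
have [l12|l21] := lerP l1 l2.
- exists l1; split=> // [|m nm m0]; first exact: inT_Z.
  by case: (split_T m nm m0) => Tm; [exact: min1|exact: le_trans (min2 _ Tm m0)].
- exists l2; split=> // [|m nm m0]; first exact: inT_W.
  case: (split_T m nm m0) => Tm; last exact: min2.
  exact: le_trans (ltW l21) (min1 _ Tm m0).
Qed.

Lemma Lmin_le (z w : nat -> nat) (n m : int) :
  (forall k, 0 < z k)%N -> (forall k, 0 < w k)%N ->
  inT z w n m -> m <= 0 -> Lmin z w n <= m.
Proof.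
move=> z0 w0 nm m0; have [l lP] := is_min_L_exists _ _ z0 w0 n.
(* Existence of a minimum rules out the default value 0 of [xget]. *)
have [_ _] : is_min_L z w n (Lmin z w n) by rewrite /Lmin; case: xgetP => [y -> //|/(_ l)].
exact.
Qed.

(** * Colouring the sites along a realisation *)

(* A site [n] is high when [L_n > - M]. The colours of the sites
   [N, N - 1, ..., 1 - M] are listed newest first, so that a jump of size [k]
   from [N + 1] lands on entry [k - 1]; sites beyond the list are [<= - M],
   hence not high. A history keeps the colours of both landing sites of each
   step, and not just their conjunction, so that histories are rectangles in
   the independent variables. *)
Definition colours (M : nat) (g : seq (bool * bool)) : seq bool :=
  [seq ab.1 && ab.2 | ab <- g] ++ nseq M true.

Fixpoint history (M : nat) (z w : nat -> nat) (N : nat) : seq (bool * bool) :=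
  if N is N'.+1 then
    let r := colours M (history M z w N') in
    (nth false r (z N).-1, nth false r (w N).-1) :: history M z w N'
  else [::].

Lemma size_history M z w N : size (history M z w N) = N.
Proof. by elim: N => //= N ->. Qed.

Lemma size_colours M g : size (colours M g) = (size g + M)%N.
Proof. by rewrite size_cat size_map size_nseq. Qed.

(** A false head means that one of the two jumps lands on a site that is not high; the path found
    from there extends by that jump. *)
Lemma colours_reach (M : nat) (z w : nat -> nat) :
  (forall k, 0 < z k)%N -> (forall k, 0 < w k)%N ->
  forall N i, nth false (colours M (history M z w N)) i = false ->
  exists2 m : int, inT z w (N%:Z - i%:Z) m & m <= - M%:Z.
Proof.
move=> z0 w0; elim=> [|N IH] i.
  (* An index [i >= M] is past the list; its site [- i] is at most [- M], in accordance with the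
     default [false]. *)
  rewrite /= nth_nseq; case: ltnP => // Mi _.
  by exists (0%:Z - i%:Z); [exact: inT_self|lia].
case: i => [|i].
  have step k : (0 < k)%N -> N%:Z - (k.-1)%:Z = N.+1%:Z - k%:Z by lia.
  rewrite /colours /= subr0 => /negbT; rewrite negb_and.
  case/orP => /negbTE /IH [m Tm mM]; exists m => //.
  - by apply: inT_Z => //; rewrite -step.
  - by apply: inT_W => //; rewrite -step.
move=> /IH[m Tm mM]; exists m => //.
by rewrite (_ : N.+1%:Z - i.+1%:Z = N%:Z - i%:Z) //; lia.
Qed.

(** * Potential and defect: the finite computations *)

Section Weights.
Context {R : realFieldType}.
Implicit Types (f : nat -> R) (r : seq bool).

Definition colour_sum f r : R := \sum_(i < size r) (nth false r i)%:R * f i.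

Lemma colour_sum_cons f c r :
  colour_sum f (c :: r) = c%:R * f 0%N + colour_sum (fun i => f i.+1) r.
Proof. by rewrite /colour_sum /= big_ord_recl. Qed.

Lemma colour_sum_ge0 f r : (forall i, 0 <= f i) -> 0 <= colour_sum f r.
Proof. by move=> f0; apply: sumr_ge0 => i _; rewrite mulr_ge0. Qed.

(** Stands for [P(Z > i)], so that [tail i - tail i.+1] is the probability of a jump of size
    [i + 1], which lands on entry [i]. *)
Variable tail : nat -> R.
Hypothesis tail0 : tail 0%N = 1.
Hypothesis tail_ge0 : forall i, 0 <= tail i.
Hypothesis tail_noninc : forall i, tail i.+1 <= tail i.

(* The probability that the next jump lands on a high site. *)
Definition hit r : R := colour_sum (fun i => tail i - tail i.+1) r.

(* The expected number of future jumps, one per time step, that would hit a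
   present high site. *)
Definition potential r : R := colour_sum tail r.

(** A new site moves every old one a step further away: weights [tail i] become [tail i.+1], and the
    total loss is [hit r]. *)
Lemma potential_cons c r : potential (c :: r) = c%:R + potential r - hit r.
Proof.
rewrite /potential colour_sum_cons tail0 mulr1 -addrA; congr (_ + _).
by rewrite /hit /colour_sum -sumrB; apply: eq_bigr => i _; ring.
Qed.

Lemma hit_ge0 r : 0 <= hit r.
Proof. by apply: colour_sum_ge0 => i; rewrite subr_ge0. Qed.

Lemma hit_le r : hit r <= 1 - tail (size r).
Proof.
rewrite -tail0 -opprB -(telescope_sumr _ (leq0n _)) big_mkord -sumrN.
by apply: ler_sum => i _; have := tail_noninc i; case: nth; rewrite /= ?mul1r ?mul0r; lra.
Qed.

Lemma hit_cons_true r : tail 0%N - tail 1%N <= hit (true :: r).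
Proof.
rewrite /hit colour_sum_cons mul1r lerDl.
by apply: colour_sum_ge0 => i; rewrite subr_ge0.
Qed.

Definition bern (p : R) (b : bool) : R := if b then p else 1 - p.

(** Given the earlier steps, the two landing colours are independent and each is high with
    probability [p]; [hist_law] identifies the product with the probability of the history. *)
Fixpoint law (M : nat) (g : seq (bool * bool)) : R :=
  if g is ab :: g' then
    let p := hit (colours M g') in law M g' * (bern p ab.1 * bern p ab.2)
  else 1.

(** At the last step, the expected drop [p (1 - p)] of the potential plus the square of its actual
    increment. *)
Definition defect (M : nat) (g : seq (bool * bool)) : R :=
  if g is ab :: g' then
    let p := hit (colours M g') in p * (1 - p) + ((ab.1 && ab.2)%:R - p) ^+ 2
  else 0.

Lemma hit_le1 r : hit r <= 1.
Proof. by have := hit_le r; have := tail_ge0 (size r); lra. Qed.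

Lemma bern_ge0 r b : 0 <= bern (hit r) b.
Proof. by have := hit_ge0 r; have := hit_le1 r; case: b => /=; lra. Qed.

Lemma law_ge0 M g : 0 <= law M g.
Proof. by elim: g => [|ab g IH] //=; rewrite !mulr_ge0 ?bern_ge0. Qed.

Lemma defect_ge0 M g : 0 <= defect M g.
Proof.
case: g => //= ab g; rewrite addr_ge0 ?sqr_ge0// mulr_ge0 ?hit_ge0//.
by rewrite subr_ge0 hit_le1.
Qed.

Definition bool_pairs : seq (bool * bool) :=
  [:: (true, true); (true, false); (false, true); (false, false)].

Fixpoint histories (N : nat) : seq (seq (bool * bool)) :=
  if N is N'.+1 then
    [seq ab :: g | g <- histories N', ab <- bool_pairs]
  else [:: [::]].

(** The squared increment has mean [2 p^2 (1 - p)], so the mean defect is [p (1 - p) (1 + 2 p)], at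
    most 3 times the mean drop [p (1 - p)] of the potential; hence the factor 1/3. *)
Lemma potential_defect_step M g :
  \sum_(ab <- bool_pairs)
    law M (ab :: g) *
      (potential (colours M (ab :: g)) + 3^-1 * defect M (ab :: g))
  <= law M g * potential (colours M g).
Proof.
rewrite /bool_pairs !big_cons big_nil /=.
rewrite /colours !map_cons !cat_cons -!/(colours M g) /= !potential_cons.
set p := hit _; set F := potential _.
have p0 : 0 <= p := hit_ge0 _; have p1 : p <= 1 := hit_le1 _.
have l0 := law_ge0 M g.
rewrite -subr_ge0.
have -> : forall l : R, l * F -
  (l * (p * p) * (1 + F - p + 3^-1 * (p * (1 - p) + (1 - p) ^+ 2)) +
   (l * (p * (1 - p)) * (0 + F - p + 3^-1 * (p * (1 - p) + (0 - p) ^+ 2)) +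
    (l * ((1 - p) * p) * (0 + F - p + 3^-1 * (p * (1 - p) + (0 - p) ^+ 2)) +
     (l * ((1 - p) * (1 - p)) * (0 + F - p + 3^-1 * (p * (1 - p) + (0 - p) ^+ 2)) + 0))))
  = l * (p * (1 - p) * (1 - p)) * (2 / 3).
  by move=> l; field.
by rewrite !mulr_ge0// subr_ge0.
Qed.

Definition mean (M N : nat) (f : seq (bool * bool) -> R) : R :=
  \sum_(g <- histories N) law M g * f g.

(** The mean potential plus a third of the accumulated mean defects does not increase with time, and
    the potential stays nonnegative. *)
Lemma sum_mean_defect M n :
  \sum_(k < n) mean M k.+1 (defect M) <= 3 * potential (nseq M true).
Proof.
suff H : mean M n (fun g => potential (colours M g)) +
    3^-1 * \sum_(k < n) mean M k.+1 (defect M) <= potential (nseq M true).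
  have : 0 <= mean M n (fun g => potential (colours M g)).
    apply: sumr_ge0 => g _; rewrite mulr_ge0 ?law_ge0//.
    exact: colour_sum_ge0.
  by lra.
elim: n => [|n IH].
  by rewrite /mean big_ord0 big_seq1 /= mul1r mulr0 addr0.
apply: le_trans IH; rewrite big_ord_recr /= mulrDr addrCA [leRHS]addrC lerD2l.
rewrite /mean mulr_sumr -big_split [histories n.+1]/(flatten _) big_allpairs_dep.
apply: ler_sum => g _; apply: le_trans (potential_defect_step M g).
by under [leRHS]eq_bigr do rewrite mulrDr mulrCA.
Qed.

(* Once the defects are below [(tail 0 - tail 1) ^ 2] two consecutive sites
   have the same colour, and if all sites are eventually high then the defects
   dominate the nonsummable tail. *)
Lemma eventually_not_high M (z w : nat -> nat) (C : R) :
  tail 1%N < 1 ->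
  (forall n, \sum_(k < n) defect M (history M z w k.+1) <= C) ->
  (forall B, exists n, B < \sum_(k < n) tail k) ->
  (exists K, forall k, (K <= k)%N ->
     defect M (history M z w k.+1) < (1 - tail 1%N) ^+ 2) ->
  exists K, forall k, (K <= k)%N ->
    nth false (colours M (history M z w k)) 0 = false.
Proof.
move=> q0 sumC divg [K small]; set r := fun k => colours M (history M z w k).
pose c k := nth false (r k) 0.
have rS k : r k.+1 = c k.+1 :: r k by [].
have defE k : defect M (history M z w k.+1) =
  hit (r k) * (1 - hit (r k)) + ((c k.+1)%:R - hit (r k)) ^+ 2 by [].
have hit_c k : c k.+1 -> 1 - tail 1%N <= hit (r k.+1).
  by rewrite rS => ->; rewrite -{1}tail0; exact: hit_cons_true.
(* A high site followed by one that is not high would have defect at least [p ^ 2], where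
   [p >= 1 - tail 1]. *)
have persist k : (K <= k)%N -> c k.+1 -> c k.+2.
  move=> Kk ck; have := small k.+1 (leqW Kk); rewrite defE.
  case: (c k.+2) => //; have := hit_c _ ck; have := hit_le1 (r k.+1).
  rewrite sub0r sqrrN; set p := hit _ => p1 qp small_p.
  have : (1 - tail 1%N) ^+ 2 <= p ^+ 2 by rewrite lerXn2r ?nnegrE//; lra.
  have : 0 <= p * (1 - p) by apply: mulr_ge0; lra.
  by move=> h1 h2; lra.
exists K.+1 => k Kk; apply/negbTE/negP => ck.
have high j : (k <= j)%N -> c j.
  move=> /subnKC <-; elim: (j - k)%N => [|i IH]; first by rewrite addn0.
  rewrite addnS; case: k Kk ck IH => // k Kk ck; rewrite addSn; apply: persist; lia.
(* With [q = 1 - tail 1] and [q <= p <= 1 - t], one gets [p (1 - p) >= q (1 - p) >= q t]. *)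
have dom j : (k <= j)%N ->
    (1 - tail 1%N) * tail (j + M)%N <= defect M (history M z w j.+1).
  move=> kj; rewrite defE; have := high j kj.
  case: j kj => [|j] kj cj; first by lia.
  have := hit_c _ cj; have := hit_le (r j.+1).
  rewrite size_colours size_history.
  have := sqr_ge0 ((c j.+2)%:R - hit (r j.+1)); have := tail_ge0 (j.+1 + M)%N.
  set t := tail _; set p := hit _; set s := _ ^+ 2 => t0 s0 pt pq.
  have : (p - (1 - tail 1%N)) * (1 - p) >= 0 by apply: mulr_ge0; lra.
  have : (1 - tail 1%N) * (1 - p - t) >= 0 by apply: mulr_ge0; lra.
  by lra.
(* The bound [dom] starts at [tail (k + M)], so the earlier terms are set aside; the remaining ones
   would exceed [C / q] and push the defects above [C]. *)
have [n] := divg (C / (1 - tail 1%N) + \sum_(i < k + M) tail i).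
apply/negP; rewrite -leNgt.
apply: (@le_trans _ _ (\sum_(i < k + M + n) tail i)).
  by rewrite addnC big_split_ord /= lerDl; exact: sumr_ge0.
rewrite big_split_ord /= addrC lerD2r ler_pdivlMr; last by lra.
rewrite mulrC mulr_sumr; apply: le_trans (sumC (k + n)%N).
rewrite big_split_ord /= -[leLHS]add0r lerD//.
  by apply: sumr_ge0 => i _; exact: (defect_ge0 M (history M z w i.+1)).
apply: ler_sum => i _; have := dom (k + i)%N (leq_addr _ _).
by rewrite addnAC.
Qed.

End Weights.

(** * Enumeration of the histories of a given length *)

Lemma historiesS N :
  histories N.+1 = [seq ab :: g | g <- histories N, ab <- bool_pairs].
Proof. by []. Qed.

Lemma mem_histories N g : (g \in histories N) = (size g == N).
Proof.
elim: N g => [|N IH] g; first by rewrite inE size_eq0.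
rewrite historiesS; apply/allpairsP/idP => [[[g' ab] /= [g'N _ ->]]|].
  by rewrite /= eqSS -IH.
case: g => [//|ab g]; rewrite /= eqSS -IH => gN; exists (g, ab); split=> //=.
by case: ab => [[] []].
Qed.

Lemma uniq_histories N : uniq (histories N).
Proof.
elim: N => // N IH; rewrite historiesS; apply: allpairs_uniq => //.
by move=> [g ab] [g' ab'] _ _ /= [-> ->].
Qed.

(** * Distribution of a single jump *)

Section IID.
Context {d : measure_display} {T : measurableType d} {R : realType}
        (P : probability T R) (X : idx -> T -> nat).
Hypothesis X_rv : nat_rvs X.
Hypothesis X_indep : mutually_independent P X.
Hypothesis X_id : identically_distributed P X.
Hypothesis X_gt0 : forall i t, (0 < X i t)%N.

Lemma measurable_X i (A : set nat) : measurable [set t | A (X i t)].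
Proof.
rewrite (_ : [set t | _] = \bigcup_(k in A) [set t | X i t = k]).
  by apply: bigcup_measurable => k _; exact: X_rv.
by apply/seteqP; split=> t /= => [AX|[k Ak /= ->] //]; exists (X i t).
Qed.

Definition survival (k : nat) : R := fine (P [set t | (k < X (0%N, false) t)%N]).

Lemma prob_gt i k : P [set t | (k < X i t)%N] = (survival k)%:E.
Proof.
rewrite /survival fineK; first exact: (X_id i _ [set x | (k < x)%N]).
by apply: fin_num_measure; exact: (measurable_X _ [set x | (k < x)%N]).
Qed.

Lemma prob_eq i k : P [set t | X i t = k.+1] = (survival k - survival k.+1)%:E.
Proof.
have mX j := measurable_X i [set x | (j < x)%N].
rewrite EFinB -!(prob_gt i) (_ : [set t | (k < X i t)%N] =
  [set t | X i t = k.+1] `|` [set t | (k.+1 < X i t)%N]).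
  rewrite measureU; first by rewrite addeK ?fin_num_measure //; exact: mX.
  - exact: X_rv.
  - exact: mX.
  - by apply/seteqP; split=> // t [/= ->]; rewrite ltnn.
by apply/seteqP; split=> t /=; lia.
Qed.

Lemma survival0 : survival 0 = 1.
Proof.
rewrite /survival (_ : [set t | _] = setT) ?probability_setT//.
by apply/seteqP; split=> t _ /=; rewrite ?X_gt0.
Qed.

Lemma survival_ge0 k : 0 <= survival k.
Proof. exact: fine_ge0. Qed.

Lemma survival_noninc k : survival k.+1 <= survival k.
Proof. by rewrite -subr_ge0 -lee_fin -(prob_eq (0%N, false)). Qed.

(** The offset [j] allows induction on [r]: the head is hit by a jump of size [j + 1], the other
    entries by longer ones. The guard [j < X] excludes truncated subtraction. *)
Lemma prob_jump_gt i r j :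
  P [set t | (j < X i t)%N && nth false r (X i t - j.+1)] =
  (colour_sum (fun k => survival (j + k) - survival (j + k).+1) r)%:E.
Proof.
elim: r j => [|c r IH] j.
  rewrite /colour_sum big_ord0 (_ : [set t | _] = set0) ?measure0//.
  by apply/seteqP; split=> // t /=; rewrite nth_nil andbF.
rewrite colour_sum_cons addn0 (_ : colour_sum _ r =
   colour_sum (fun k => survival (j.+1 + k) - survival (j.+1 + k).+1) r); last first.
  by apply: eq_bigr => k _; rewrite addnS addSn.
rewrite EFinD -IH (_ : [set t | _] =
  [set t | c /\ X i t = j.+1] `|`
  [set t | (j.+1 < X i t)%N && nth false r (X i t - j.+2)]); last first.
  apply/seteqP; split=> t /=.
    move=> /andP[jX]; have [->|Xj] := eqVneq (X i t) j.+1.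
      by rewrite subnn; left.
    have -> : (X i t - j.+1 = (X i t - j.+2).+1)%N by lia.
    by right; apply/andP; split=> //; lia.
  move=> [[c1 ->]|/andP[jX rX]]; first by rewrite ltnSn subnn.
  have -> : (X i t - j.+1 = (X i t - j.+2).+1)%N by lia.
  by apply/andP; split=> //; lia.
rewrite measureU.
- congr (_ + _)%E; case: c => /=; rewrite ?mul1r ?mul0r.
    rewrite -(prob_eq i); congr (P _).
    by apply/seteqP; split=> t //= [].
  rewrite (_ : [set t | _] = set0) ?measure0//.
  by apply/seteqP; split=> t //= [].
- exact: (measurable_X i [set x | c /\ x = j.+1]).
- exact: (measurable_X i [set x | (j.+1 < x)%N && nth false r (x - j.+2)]).
- by apply/seteqP; split=> // t /= [[_ ->]]; rewrite ltnn.
Qed.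

Lemma prob_jump i r b :
  P [set t | nth false r (X i t).-1 = b] = (bern (hit survival r) b)%:E.
Proof.
have true_case : P [set t | nth false r (X i t).-1] = (hit survival r)%:E.
  rewrite -(prob_jump_gt i r 0); congr (P _); apply/seteqP; split=> t /=;
  by rewrite X_gt0 subn1.
case: b => //.
rewrite (_ : [set t | _] = ~` [set t | nth false r (X i t).-1]).
  rewrite probability_setC ?true_case//.
  exact: (measurable_X i [set x | nth false r x.-1]).
by apply/seteqP; split=> t /=; case: nth.
Qed.

(** * Law of the random history and expectations of its functions *)

Definition hist M N (t : T) : seq (bool * bool) :=
  history M (fun k => X (k, false) t) (fun k => X (k, true) t) N.

Lemma histS M N ab g t : hist M N.+1 t = ab :: g <->
  [/\ hist M N t = g,
      nth false (colours M g) (X (N.+1, false) t).-1 = ab.1 &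
      nth false (colours M g) (X (N.+1, true) t).-1 = ab.2].
Proof.
rewrite /hist /=; case: ab => a b; split=> [[<- <- ->] //|[-> -> ->] //].
Qed.

Lemma measurable_hist M N g : measurable [set t | hist M N t = g].
Proof.
elim: N g => [|N IH] g.
  have [->|/eqP g0] := eqVneq g [::].
    by rewrite (_ : [set t | _] = setT) //; apply/seteqP; split.
  rewrite (_ : [set t | _] = set0) //; apply/seteqP; split=> // t.
  by rewrite /hist /= => /esym.
case: g => [|ab g].
  by rewrite (_ : [set t | _] = set0) //; apply/seteqP; split.
rewrite (_ : [set t | _] = [set t | hist M N t = g] `&`
  [set t | nth false (colours M g) (X (N.+1, false) t).-1 = ab.1] `&`
  [set t | nth false (colours M g) (X (N.+1, true) t).-1 = ab.2]).
  apply: measurableI; first apply: measurableI => //.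
    exact: (measurable_X _ [set x | nth false (colours M g) x.-1 = ab.1]).
  exact: (measurable_X _ [set x | nth false (colours M g) x.-1 = ab.2]).
apply/seteqP; split=> t /=; first by move=> /histS[].
by move=> [[? ?] ?]; apply/histS.
Qed.

(** Carrying events of later variables makes the induction work: for fixed [g] the last step
    constrains only the two variables of index [N + 1], and these constraints join the events of
    [J]. The base case is mutual independence. *)
Lemma hist_law_indep M N g (J : seq idx) (A : idx -> set nat) :
  size g = N -> uniq J -> (forall j, j \in J -> (N < j.1)%N) ->
  P [set t | hist M N t = g /\ forall j, j \in J -> A j (X j t)] =
  ((law survival M g)%:E * \prod_(j <- J) P [set t | A j (X j t)])%E.
Proof.
elim: N g J A => [|N IH] [|ab g] // J A gN uJ J_gt.
  rewrite mul1e -X_indep//; congr (P _); apply/seteqP; split=> t /=.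
    by case.
  by [].
pose jZ : idx := (N.+1, false); pose jW : idx := (N.+1, true).
have J_ne j : j \in J -> (j == jZ = false) /\ (j == jW = false).
  by move=> /J_gt jN; split; apply/negbTE/eqP => jE; rewrite jE ltnn in jN.
pose A' (j : idx) : set nat :=
  if j == jZ then [set x | nth false (colours M g) x.-1 = ab.1] else
  if j == jW then [set x | nth false (colours M g) x.-1 = ab.2] else A j.
have := IH g (jZ :: jW :: J) A'; rewrite !big_cons.
have -> : (\prod_(j <- J) P [set t | A' j (X j t)] =
           \prod_(j <- J) P [set t | A j (X j t)])%E.
  apply: eq_big_seq => j jJ; congr (P _); apply/seteqP.
  by rewrite /A'; have [-> ->] := J_ne _ jJ; split.
have A'Z : A' jZ = [set x | nth false (colours M g) x.-1 = ab.1].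
  by rewrite /A' eqxx.
have A'W : A' jW = [set x | nth false (colours M g) x.-1 = ab.2].
  by rewrite /A' /jW /jZ !xpair_eqE !eqxx.
have -> : P [set t | A' jZ (X jZ t)] = (bern (hit survival (colours M g)) ab.1)%:E.
  by rewrite A'Z; exact: prob_jump.
have -> : P [set t | A' jW (X jW t)] = (bern (hit survival (colours M g)) ab.2)%:E.
  by rewrite A'W; exact: prob_jump.
rewrite !muleA /= mulrA !EFinM => <-.
- congr (P _); apply/seteqP; split=> t /=.
    move=> [/histS[hN hZ hW] AJ]; split=> // j; rewrite !inE /A'.
    have [-> //|_] := eqVneq j jZ; have [-> //|_] := eqVneq j jW.
    exact: AJ.
  move=> [hN AJ]; split.
    apply/histS; split=> //.
      by have := AJ jZ; rewrite inE eqxx A'Z; exact.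
    by have := AJ jW; rewrite !inE eqxx orbT A'W; exact.
  move=> j jJ; have := AJ j; rewrite !inE jJ !orbT /A'.
  by have [-> ->] := J_ne _ jJ; exact.
- by case: gN.
- rewrite /= !inE uJ andbT negb_or -andbA; apply/and3P; split.
  - by apply/eqP.
  - by apply/negP => /J_ne[]; rewrite eqxx.
  - by apply/negP => /J_ne[_]; rewrite eqxx.
- move=> j; rewrite !inE => /orP[/eqP -> //|/orP[/eqP -> //|/J_gt]].
  exact: ltnW.
Qed.

Lemma hist_law M N g : size g = N ->
  P [set t | hist M N t = g] = (law survival M g)%:E.
Proof.
move=> gN; have := hist_law_indep M N g [::] (fun=> setT) gN isT.
rewrite big_nil mule1 => <- //.
by congr (P _); apply/seteqP; split=> t //= [].
Qed.

(** A history of given length takes finitely many values, so integrals of its functions become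
    finite sums. *)
Lemma hist_fun_indic M N (f : seq (bool * bool) -> R) :
  (fun t => (f (hist M N t))%:E) = (fun t => \sum_(g <- histories N)
      (f g)%:E * (\1_[set t | hist M N t = g] t)%:E)%E.
Proof.
apply/funext => t.
have hN : hist M N t \in histories N by rewrite mem_histories size_history.
rewrite (big_rem _ hN) /= big1_seq ?adde0.
  by rewrite indicE mem_set// mule1.
move=> g /=; rewrite mem_rem_uniq ?uniq_histories// inE => /andP[gN _].
by rewrite indicE memNset ?mule0// => /= hg; rewrite hg eqxx in gN.
Qed.

Lemma measurable_hist_fun M N (f : seq (bool * bool) -> R) :
  measurable_fun setT (fun t => (f (hist M N t))%:E).
Proof.
rewrite hist_fun_indic; apply: emeasurable_sum => g.
apply: emeasurable_funM => //; apply/measurable_EFinP.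
exact: measurable_indic (measurable_hist M N g).
Qed.

Lemma integral_hist M N (f : seq (bool * bool) -> R) : (forall g, 0 <= f g) ->
  (\int[P]_t (f (hist M N t))%:E = (mean survival M N f)%:E)%E.
Proof.
move=> f0; rewrite hist_fun_indic ge0_integral_sum//.
- rewrite /mean -sumEFin; apply: eq_big_seq => g; rewrite mem_histories => /eqP gN.
  rewrite ge0_integralZl_EFin//.
  - rewrite mulrC EFinM integral_indic//; last exact: measurable_hist.
    by rewrite setIT -(hist_law _ _ _ gN).
  - apply/measurable_EFinP.
    exact: measurable_indic (measurable_hist M N g).
- move=> g; apply: emeasurable_funM => //; apply/measurable_EFinP.
  exact: measurable_indic (measurable_hist M N g).
- by move=> g t _; rewrite mule_ge0// lee_fin.
Qed.

Let defect_pos M g : 0 <= defect survival M g.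
Proof.
by apply: defect_ge0; [exact: survival0|exact: survival_ge0|exact: survival_noninc].
Qed.

(** * Almost sure conclusions *)

(** The total defect has expectation at most 3 times the initial potential, hence is almost surely
    finite. *)
Lemma ae_sum_defect M : {ae P, forall t, exists C, forall n,
  \sum_(k < n) defect survival M (hist M k.+1 t) <= C}.
Proof.
pose F k t := (defect survival M (hist M k.+1 t))%:E.
have F0 k t : (0 <= F k t)%E by rewrite lee_fin.
have mF k : measurable_fun setT (F k) by exact: measurable_hist_fun.
have intF : P.-integrable setT (fun t => \sum_(0 <= k <oo) F k t)%E.
  apply/integrableP; split.
    by apply: (ge0_emeasurable_sum (P := xpredT)).
  under eq_integral do rewrite gee0_abs ?nneseries_ge0//.
  rewrite integral_nneseries//.
  apply: (@le_lt_trans _ _ (3 * potential survival (nseq M true))%:E); last exact: ltry.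
  apply: lime_le; first by apply: is_cvg_nneseries => *; exact: integral_ge0.
  apply: nearW => n; rewrite big_mkord.
  under eq_bigr do rewrite integral_hist//.
  rewrite sumEFin lee_fin; apply: sum_mean_defect;
    [exact: survival0|exact: survival_ge0|exact: survival_noninc].
apply: filterS (integrable_ae measurableT intF) => t /(_ I) fin.
exists (fine (\sum_(0 <= k <oo) F k t))%E => n.
rewrite -lee_fin fineK// -sumEFin.
have := @nneseries_lim_ge _ (F^~ t) xpredT 0 n; rewrite big_mkord; exact.
Qed.

(** The mean of [Z] is the sum of [P(Z > k)], so bounded partial sums would make it finite. *)
Lemma sum_survival_unbounded :
  (\int[P]_t ((X (0%N, false) t)%:R : R)%:E = +oo)%E ->
  forall B, exists n, B < \sum_(k < n) survival k.
Proof.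
move=> EX B; apply: contrapT => noB; set i := (0%N, false) in EX.
pose A k := [set t | (k < X i t)%N].
have mA k : measurable (A k) by exact: (measurable_X i [set x | (k < x)%N]).
have XE t : ((X i t)%:R : R)%:E = (\sum_(0 <= k <oo) (\1_(A k) t)%:E)%E.
  rewrite (nneseries_split 0 (X i t)); last by move=> *; rewrite lee_fin.
  rewrite eseries0 ?adde0; last first.
    move=> k Xk _; rewrite indicE memNset//= /A /=; lia.
  rewrite add0n (eq_big_nat _ _ (F2 := fun=> 1%:E)); last first.
    by move=> k /andP[_ kX]; rewrite indicE mem_set.
  by rewrite sumEFin sumr_const_nat subn0.
have int_A k : (\int[P]_t (\1_(A k) t)%:E = (survival k)%:E)%E.
  by rewrite integral_indic// setIT; exact: prob_gt.
have : (\int[P]_t ((X i t)%:R : R)%:E <= B%:E)%E.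
  under eq_integral do rewrite XE.
  rewrite integral_nneseries//; last first.
    by move=> k; apply/measurable_EFinP; exact: measurable_indic.
  apply: lime_le; first by apply: is_cvg_nneseries => *; apply: integral_ge0.
  apply: nearW => n; rewrite big_mkord.
  under eq_bigr do rewrite int_A.
  rewrite sumEFin lee_fin leNgt; apply/negP => Bn; apply: noB; by exists n.
by rewrite EX.
Qed.

Lemma ae_eventually_not_high M :
  (0 < P [set t | X (0%N, false) t = 1%N])%E ->
  (\int[P]_t ((X (0%N, false) t)%:R : R)%:E = +oo)%E ->
  {ae P, forall t, exists K, forall k, (K <= k)%N ->
    nth false (colours M (hist M k t)) 0 = false}.
Proof.
move=> q1 EX; apply: filterS (ae_sum_defect M) => t [C sumC].
have s1 : survival 1 < 1.
  by move: q1; rewrite prob_eq survival0 lte_fin subr_gt0.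
apply: (eventually_not_high _ survival0 survival_ge0 survival_noninc _ _ _ C) => //.
  exact: sum_survival_unbounded.
(* Bounded sums of nonnegative defects converge, so the defects tend to 0 and fall below the
   required threshold. *)
have /cvg_series_cvg_0 : cvgn (series (fun k => defect survival M (hist M k.+1 t))).
  apply: nondecreasing_is_cvgn.
    by apply: nondecreasing_series => k _ _.
  by exists C => _ [n _ <-]; rewrite /series /= big_mkord.
move=> /cvgrPdist_lt /(_ ((1 - survival 1) ^+ 2)) [|K _ smallK].
  by rewrite exprn_gt0// subr_gt0.
exists K => k /smallK; rewrite sub0r normrN ger0_norm; first exact.
exact: defect_pos M (hist M k.+1 t).
Qed.

End IID.

Theorem theorem3 (d : measure_display) (T : measurableType d) (R : realType)
  (P : probability T R) (X : idx -> T -> nat) :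
  nat_rvs X ->
  mutually_independent P X ->
  identically_distributed P X ->
  (forall i t, (0 < X i t)%N) ->
  (forall k : nat, (0 < k)%N -> (0 < P [set t | X (0%N, false) t = k])%E) ->
  (\int[P]_t ((X (0%N, false) t)%:R : R)%:E = +oo)%E ->
  {ae P, forall t, forall M : int,
      \forall n \near \oo,
        Lmin (fun k => X (k, false) t) (fun k => X (k, true) t) n%:Z <= M}.
Proof.
move=> X_rv X_indep X_id X_gt0 q_gt0 EX.
(* Natural thresholds suffice, since [- |M| <= M]; they give a countable intersection of almost sure
   events. *)
have : {ae P, forall t, forall M, exists K, forall k, (K <= k)%N ->
    nth false (colours M (hist X M k t)) 0 = false}.
  apply: ae_foralln => M; apply: ae_eventually_not_high => //.
  exact: q_gt0.
apply: filterS => t low M; have [K lowK] := low `|M|%N.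
exists K => // n /= /lowK /colours_reach [||m Tm mM]; try by move=> k; exact: X_gt0.
rewrite subr0 in Tm; apply: (@le_trans _ _ m); last by lia.
by apply: Lmin_le => //; lia.
Qed.
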